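(* For all $a,b\in\mathbb{N}$, $T_7([a,b,G])$ is a sum of monomials $[c,d,G]$ with $c+d<a+b$. Moreover, if $a>0$, then $T_7([a,b,G])=[a-1,b,G]+(\text{a sum of monomials earlier than }[a-1,b,G])$.
   Context: For an odd prime $p$, $T_p:\mathbb{Z}/2[[x]]\to\mathbb{Z}/2[[x]]$ is the map $\sum c_nx^n\mapsto\sum c_{pn}x^n+\sum c_nx^{pn}$. Let $D=\sum_{n>0,\ \gcd(n,6)=1}x^{n^2}\in\mathbb{Z}/2[[x]]$. Let $g:\mathbb{N}\to\mathbb{N}$ be the function with $g(0)=0$, $g(2n)=4g(n)$, $g(2n+1)=g(2n)+1$. For $a,b\in\mathbb{N}$ put $[a,b,G]=D^{5+6g(a)+12g(b)}$; these are exactly the $D^n$ with $n>0$, $n\equiv5\pmod 6$, each arising from a unique $(a,b)$. These monomials are totally ordered by: $[c,d,G]$ is earlier than $[a,b,G]$ if $c+d<a+b$, or if $c+d=a+b$ and $d<b$. *)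

(* Defs.v *)
From HB Require Import structures.
From mathcomp Require Import all_boot all_order all_algebra.
From mathcomp Require Import boolp.

Set Implicit Arguments.
Unset Strict Implicit.
Unset Printing Implicit Defensive.

Import GRing.Theory.
Local Open Scope ring_scope.

(* Formal power series R[[x]]: the series \sum_n c_n x^n is represented by its
   coefficient function n |-> c_n, wrapped in a record so that the ring
   structure is the Cauchy product and not the pointwise one. *)
Record series (R : Type) := Series { coefs : nat -> R }.
Coercion coefs : series >-> Funclass.

HB.instance Definition _ (R : Type) := gen_eqMixin (series R).
HB.instance Definition _ (R : Type) := gen_choiceMixin (series R).

Lemma seriesP (R : Type) (f h : series R) : f =1 h -> f = h.
Proof. by case: f h => [f] [h] /= /funext ->. Qed.

Section SeriesRing.
Variable R : comNzRingType.
Implicit Types f h k : series R.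

Definition series0 : series R := Series (fun=> 0).
Definition seriesN f : series R := Series (fun n => - f n).
Definition seriesD f h : series R := Series (fun n => f n + h n).
Definition series1 : series R := Series (fun n => (n == 0%N)%:R).
Definition seriesM f h : series R :=
  Series (fun n => \sum_(i < n.+1) f i * h (n - i)%N).

Fact seriesDA : associative seriesD.
Proof. by move=> f h k; apply: seriesP => n /=; rewrite addrA. Qed.
Fact seriesDC : commutative seriesD.
Proof. by move=> f h; apply: seriesP => n /=; rewrite addrC. Qed.
Fact series0D : left_id series0 seriesD.
Proof. by move=> f; apply: seriesP => n /=; rewrite add0r. Qed.
Fact seriesND : left_inverse series0 seriesN seriesD.
Proof. by move=> f; apply: seriesP => n /=; rewrite addNr. Qed.

HB.instance Definition _ :=
  GRing.isZmodule.Build (series R) seriesDA seriesDC series0D seriesND.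

Let trunc f n : {poly R} := \poly_(i < n) f i.

Let seriesM_trunc f h n m : (n < m)%N ->
  seriesM f h n = (trunc f m * trunc h m)`_n.
Proof.
move=> nm; rewrite coefM /=; apply: eq_bigr => i _.
have im : (i < m)%N by apply: leq_trans nm; apply: ltn_ord.
by rewrite !coef_poly im (leq_ltn_trans (leq_subr _ _) nm).
Qed.

Fact seriesMC : commutative seriesM.
Proof.
by move=> f h; apply: seriesP => n; rewrite !(seriesM_trunc _ _ (ltnSn n)) mulrC.
Qed.

Fact seriesMA : associative seriesM.
Proof.
move=> f h k; apply: seriesP => n.
transitivity ((trunc f n.+1 * (trunc h n.+1 * trunc k n.+1))`_n).
  rewrite coefM; apply: eq_bigr => i _.
  have le_in : (i <= n)%N by rewrite -ltnS.
  rewrite coef_poly ltn_ord (seriesM_trunc h k (m := n.+1)) //.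
  by rewrite ltnS leq_subr.
rewrite mulrA coefM; apply: eq_bigr => i _.
by rewrite coef_poly ltnS leq_subr (seriesM_trunc f h (m := n.+1)) ?ltn_ord.
Qed.

Fact series1M : left_id series1 seriesM.
Proof.
move=> f; apply: seriesP => n /=.
by rewrite big_ord_recl /= mul1r subn0 big1 ?addr0 // => i _; rewrite mul0r.
Qed.

Fact seriesMDl : left_distributive seriesM +%R.
Proof.
move=> f h k; apply: seriesP => n /=; rewrite -big_split /=.
by apply: eq_bigr => i _; rewrite mulrDl.
Qed.

Fact series1_neq0 : series1 != 0.
Proof.
by apply/eqP => /(congr1 (fun f : series R => f 0%N)) /= /eqP; rewrite oner_eq0.
Qed.

HB.instance Definition _ :=
  GRing.Zmodule_isComNzRing.Build (series R)
    seriesMA seriesMC series1M seriesMDl series1_neq0.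

End SeriesRing.

Definition hecke (p : nat) (f : series 'F_2) : series 'F_2 :=
  Series (fun n => f (p * n)%N + (if (p %| n)%N then f (n %/ p)%N else 0)).

(* m ^ 2 = n forces m <= n, so ranging over m < n.+1 loses no term. *)
Definition D : series 'F_2 :=
  Series (fun n =>
    \sum_(m < n.+1 | [&& (0 < m)%N, coprime m 6 & (m ^ 2 == n)%N]) 1).

(* The first argument of g_rec is fuel; n halvings suffice to exhaust n. *)
Fixpoint g_rec (k n : nat) : nat :=
  if k is k'.+1 then (4 * g_rec k' n./2 + odd n)%N else 0%N.
Definition g (n : nat) : nat := g_rec n n.

Fact g_recE k n : (n <= k)%N -> g_rec k n = g n.
Proof.
rewrite /g; elim/ltn_ind: n k => -[|n] IH k le_nk.
  by elim: k {le_nk IH} => //= k ->.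
case: k le_nk => // k le_nk /=.
have lt_h : (uphalf n < n.+1)%N by rewrite ltnS leq_uphalf_double -addnn leq_addr.
have le_hn : (uphalf n <= n)%N by rewrite -ltnS.
by rewrite !IH // (leq_trans le_hn).
Qed.

Fact g0 : g 0 = 0%N. Proof. by []. Qed.

Fact gE n : g n = (4 * g n./2 + odd n)%N.
Proof.
rewrite -(@g_recE n.+1 n) //= g_recE //.
by rewrite leq_half_double -addnn ltnW // ltnS leq_addr.
Qed.

Fact g_even n : g (2 * n) = (4 * g n)%N.
Proof. by rewrite gE mul2n doubleK odd_double addn0. Qed.

Fact g_odd n : g (2 * n + 1) = (g (2 * n) + 1)%N.
Proof.
by rewrite gE g_even addn1 mul2n /= uphalf_double odd_double.
Qed.

Definition monG (a b : nat) : series 'F_2 := D ^+ (5 + 6 * g a + 12 * g b)%N.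

(* (a, b) |-> monG a b is injective, so the total order on the monomials is
   expressed on their index pairs: earlier (c, d) (a, b) says that monG c d
   is earlier than monG a b. *)
Definition earlier (u v : nat * nat) : bool :=
  (u.1 + u.2 < v.1 + v.2)%N ||
  ((u.1 + u.2 == v.1 + v.2)%N && (u.2 < v.2)%N).

(* Main.v *)
Require Import Defs.
From mathcomp Require Import all_boot all_order all_algebra.
From mathcomp Require Import zify ring.

(** Write [X = D], [Y = D(x^7)], [T = T_7] and [t = X^6]. Everything rests on the
    modular equation [X^8 + Y^8 + X Y + (X Y)^4 = 0]. The coefficient of [X Y] at [x^N]
    counts modulo 2 the pairs [(m, n)] with [m, n = 1 mod 6] and [m^2 + 7 n^2 = N].
    Multiplying [m + n sqrt(-7)] by powers of [pi / pi'], where [2 = pi pi'] in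
    [Z[(1 + sqrt(-7)) / 2]], gives involutions which leave only [N = 8 k^2] and
    [N = 56 k^2], up to pairs which division by [pi^2] matches with those of [N / 4].

    Since [T f] is the sum of the decimation of [f] and of [f(x^7)], a relation
    symmetric in [X] and [Y] yields a linear recurrence for [T(X^n)]. The modular
    equation implies [X^24 + Y^24 + (X Y)^3 + (X Y)^6 = 0], whose [2q]-th power, for
    [q = 2^k], gives
      [T(X^5 t^(m+8q)) = t^(8q) T(X^5 t^m) + t^q T(X^5 t^(m+q)) + t^(2q) T(X^5 t^(m+2q))].

    The monomial [a,b,G] is [X^5 t^m], where [a] and [b] are made of the binary digits
    of [m] of even and odd rank. Call [(a, b)] the weight of [m], ordered by [earlier].
    Adding [2^k] to [m] adds the weights if no carry occurs, and gives less otherwise;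
    moreover [2^k] has smaller weight than [2^(k+1)], and [2^(k+2)] has exactly twice
    the weight of [2^k]. Taking [8q] to be the leading binary digit of an index
    [m + 8q], the second term of the recurrence is therefore negligible, and exactly
    one of the other two contributes the leading monomial. *)

Set Implicit Arguments.
Unset Strict Implicit.
Unset Printing Implicit Defensive.
Import GRing.Theory.
Local Open Scope ring_scope.

(** * Formal power series *)

Lemma big_involution (V : nmodType) (T : eqType) (f : T -> T) (F : T -> V) (s : seq T) :
  (forall x, F (f x) = F x) -> (forall x, F x *+ 2 = 0) ->
  uniq s -> {in s, forall x, f x \in s} -> {in s, cancel f f} ->
  \sum_(x <- s) F x = \sum_(x <- s | f x == x) F x.
Proof.
move=> fF F2; have [n] := ubnP (size s).
elim: n s => // n IH [|x s] /= lt_sn us fs fK; first by rewrite !big_nil.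
have /andP[xs us'] := us; have fxs := fs x (mem_head _ _).
have [fx|fx] := eqVneq (f x) x.
  rewrite !big_cons fx eqxx IH // => y ys; last by rewrite fK ?inE ?ys ?orbT.
  have := fs y; rewrite !inE ys orbT => /(_ isT) /predU1P[fy|//].
  by case/negP: xs; rewrite -fx -{1}fy fK // inE ys orbT.
rewrite inE (negbTE fx) /= in fxs.
rewrite !big_cons (negbTE fx) (big_rem _ fxs) /= fF addrA -mulr2n F2 add0r.
rewrite [RHS](big_rem _ fxs) /= fK ?mem_head // [x == _]eq_sym (negbTE fx) add0r.
have memr y : y \in rem (f x) s -> [/\ y \in s, y != x & y != f x].
  rewrite mem_rem_uniq // inE => /andP[yfx ys]; split=> //.
  by apply: contraNneq xs => <-.
apply: IH; rewrite ?rem_uniq //.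
- by rewrite size_rem // (leq_ltn_trans (leq_pred _)).
- move=> y /memr[ys yx yfx]; rewrite mem_rem_uniq // inE.
  have fKy : f (f y) = y by rewrite fK // inE ys orbT.
  have := fs y; rewrite !inE ys orbT => /(_ isT) /predU1P[fy|->].
    by rewrite -fKy fy eqxx in yfx.
  rewrite andbT; apply: contraNneq yx => /(congr1 f).
  by rewrite fKy fK ?mem_head // => ->.
- by move=> y /memr[ys _ _]; rewrite fK // inE ys orbT.
Qed.

Section Series.
Variable R : comNzRingType.
Implicit Types f h : series R.

Lemma coef_seriesD f h n : (f + h) n = f n + h n.
Proof. by []. Qed.

Lemma coef_seriesM f h n : (f * h) n = \sum_(i < n.+1) f i * h (n - i)%N.
Proof. by []. Qed.

Definition dilate (p : nat) f : series R :=
  Series (fun n => if (p %| n)%N then f (n %/ p)%N else 0).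

Lemma coef_dilate p f n :
  dilate p f n = if (p %| n)%N then f (n %/ p)%N else 0.
Proof. by []. Qed.

Definition decimate (p : nat) f : series R := Series (fun n => f (p * n)%N).

Lemma decimate0 p : decimate p 0 = 0.
Proof. exact: seriesP. Qed.

Lemma decimateD p f h : decimate p (f + h) = decimate p f + decimate p h.
Proof. exact: seriesP. Qed.

Lemma dilateD p f h : dilate p (f + h) = dilate p f + dilate p h.
Proof. by apply: seriesP => n /=; case: ifP; rewrite ?addr0. Qed.

Lemma dilate1 f : dilate 1 f = f.
Proof. by apply: seriesP => n /=; rewrite dvd1n divn1. Qed.

Lemma dilate_dilate p q f : (0 < p)%N -> dilate p (dilate q f) = dilate (p * q) f.
Proof.
move=> p0; apply: seriesP => n /=; case: (boolP (p %| n)%N) => [/dvdnP[m ->]|pn].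
  by rewrite mulnK // mulnC dvdn_pmul2r // divnMr.
by case: ifP => // /(dvdn_trans (dvdn_mulr q (dvdnn p))); rewrite (negbTE pn).
Qed.

Lemma decimate_dilate p q f : (0 < q)%N -> coprime p q ->
  decimate p (dilate q f) = dilate q (decimate p f).
Proof.
move=> q0 cpq; apply: seriesP => n /=; rewrite Gauss_dvdr 1?coprime_sym //.
by case: ifP => // /dvdnP[m ->]; rewrite mulnA !mulnK.
Qed.

Lemma coef_dilateM p f h n : (0 < p)%N ->
  (dilate p f * h) n = \sum_(j < (n %/ p).+1) f j * h (n - p * j)%N.
Proof.
move=> p0; rewrite coef_seriesM (bigID (fun i : 'I_n.+1 => p %| i)%N) /=.
rewrite [X in _ + X]big1 ?addr0 => [|i /negbTE ->]; last by rewrite mul0r.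
have le_pn (j : 'I_(n %/ p).+1) : (p * j < n.+1)%N.
  by rewrite ltnS mulnC -leq_divRL // -ltnS.
rewrite (reindex_onto (fun j => Ordinal (le_pn j)) (fun i => inord (i %/ p))) /=.
  apply: eq_big => [j|j _]; rewrite dvdn_mulr // mulKn //.
  by rewrite inord_val eqxx.
move=> i pi; apply/val_inj; rewrite /= inordK; first by rewrite mulnC divnK.
by rewrite ltnS leq_div2r // -ltnS.
Qed.

Lemma dilateM p f h : (0 < p)%N -> dilate p (f * h) = dilate p f * dilate p h.
Proof.
move=> p0; apply: seriesP => n; rewrite coef_dilateM //=.
case: ifP => [/dvdnP[m ->]|pn].
  rewrite mulnK //; apply: eq_bigr => j _.
  by rewrite mulnC -mulnBr dvdn_mulr // mulKn.
rewrite big1 // => -[j /= jn] _; rewrite ltnS leq_divRL // mulnC in jn.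
by rewrite dvdn_subl // ?pn ?mulr0 // dvdn_mulr.
Qed.

Lemma dilateX p f n : (0 < p)%N -> dilate p (f ^+ n) = dilate p f ^+ n.
Proof.
move=> p0; elim: n => [|n IH]; last by rewrite !exprS dilateM // IH.
apply: seriesP => i /=; case: ifP => [/dvdnP[j ->]|].
  by rewrite mulnK // muln_eq0 [p == 0%N]eqn0Ngt p0 orbF.
by case: i => //; rewrite dvdn0.
Qed.

Lemma decimate_dilateM p f h : (0 < p)%N ->
  decimate p (dilate p f * h) = f * decimate p h.
Proof.
move=> p0; apply: seriesP => n.
transitivity ((dilate p f * h) (p * n)%N) => //.
rewrite coef_dilateM // mulKn // coef_seriesM.
by apply: eq_bigr => j _; rewrite -mulnBr.
Qed.

Definition low_vanishing (n : nat) f : Prop := forall i, (i < n)%N -> f i = 0.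

Lemma low_vanishingM f h a b :
  low_vanishing a f -> low_vanishing b h -> low_vanishing (a + b) (f * h).
Proof.
move=> fa hb n nab; rewrite coef_seriesM big1 // => -[i /= ni] _.
by case: (ltnP i a) => ia; [rewrite fa ?mul0r|rewrite hb ?mulr0 //; lia].
Qed.

Lemma lowest_coefM f h a b : low_vanishing a f -> low_vanishing b h ->
  (f * h) (a + b)%N = f a * h b.
Proof.
move=> fa hb; have lt_a : (a < (a + b).+1)%N by rewrite ltnS leq_addr.
rewrite coef_seriesM (bigD1 (Ordinal lt_a)) //= addKn big1 ?addr0 // => -[i /= ni].
rewrite -val_eqE /= => ia; case: (ltngtP i a) ia => // ia _; first by rewrite fa ?mul0r.
by rewrite hb ?mulr0 //; lia.
Qed.

Lemma low_vanishingX f a n : low_vanishing a f -> low_vanishing (n * a) (f ^+ n).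
Proof.
move=> fa; elim: n => [|n IH] //.
by rewrite exprS mulSn; apply: low_vanishingM.
Qed.

Lemma lowest_coefX f a n : low_vanishing a f -> (f ^+ n) (n * a)%N = f a ^+ n.
Proof.
move=> fa; elim: n => [|n IH] //.
by rewrite !exprS mulSn lowest_coefM ?IH //; apply: low_vanishingX.
Qed.

Lemma low_vanishing_eq0 f : (forall n, low_vanishing n f -> f n = 0) -> f = 0.
Proof.
move=> f0; suff fn n : low_vanishing n f by apply: seriesP => n; apply: (fn n.+1).
elim: n => // n IH i; rewrite ltnS leq_eqVlt => /predU1P[->|]; [exact: f0|exact: IH].
Qed.

End Series.

Lemma mul_series_eq0 (R : idomainType) (f h : series R) a :
  low_vanishing a f -> f a != 0 -> f * h = 0 -> h = 0.
Proof.
move=> fa /negbTE fa0 fh; apply: low_vanishing_eq0 => n hn.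
by have /eqP := lowest_coefM fa hn; rewrite fh eq_sym mulf_eq0 fa0 => /eqP.
Qed.

Lemma pchar_F2 : 2 \in [pchar 'F_2].
Proof. exact: pchar_Fp. Qed.

Lemma pchar_series : 2 \in [pchar (series 'F_2)].
Proof.
by rewrite inE /=; apply/eqP/seriesP => n /=; rewrite (addrr_pchar2 pchar_F2).
Qed.

Lemma series_sqr (f : series 'F_2) : f ^+ 2 = dilate 2 f.
Proof.
apply: seriesP => n; rewrite expr2 coef_seriesM.
rewrite (big_involution (f := @rev_ord n.+1)) ?index_enum_uniq //=; first last.
- by move=> i _; rewrite rev_ordK.
- by move=> i _; rewrite mem_index_enum.
- by move=> i; rewrite mulr2n (addrr_pchar2 pchar_F2).
- by move=> i; rewrite /= subSS subKn 1?mulrC // -ltnS.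
case: ifP => [/dvdnP[m ->]|n2]; last first.
  by rewrite big_pred0 // => i; apply/eqP => /(congr1 val) /=; have := ltn_ord i; lia.
have lt_m : (m < (m * 2).+1)%N by lia.
rewrite (big_pred1 (Ordinal lt_m)) /= => [|i].
  rewrite mulnK // -[X in (X - _)%N]mulnC mul2n -addnn addnK.
  by case: (f m) => -[|[|//]] ?; apply/val_inj.
by rewrite -[LHS]val_eqE -[RHS]val_eqE /=; have := ltn_ord i; lia.
Qed.

Lemma series_exp2 (f : series 'F_2) j : f ^+ (2 ^ j) = dilate (2 ^ j) f.
Proof.
elim: j => [|j IH]; first by rewrite dilate1.
by rewrite expnS mulnC exprM IH series_sqr dilate_dilate // mulnC.
Qed.

(** * Generating series *)

Definition enumerates (T : eqType) (s : seq T) (A : pred T) : Prop :=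
  uniq s /\ s =i A.

Lemma enumerates_size (T : eqType) (s t : seq T) (A : pred T) :
  enumerates s A -> enumerates t A -> size s = size t.
Proof.
by move=> [us sA] [ut tA]; apply/perm_size/uniq_perm => // x; rewrite sA tA.
Qed.

Lemma enumerates_map (T U : eqType) (A : pred T) (B : pred U)
    (h : T -> U) (k : U -> T) (s : seq T) :
  {in A, forall x, B (h x) /\ k (h x) = x} ->
  {in B, forall y, A (k y) /\ h (k y) = y} ->
  enumerates s A -> enumerates (map h s) B.
Proof.
move=> hK kK [us sA]; split.
  rewrite map_inj_in_uniq // => x y; rewrite !sA => /hK[_ ex] /hK[_ ey] e.
  by rewrite -ex e ey.
move=> y; apply/mapP/idP => [[x]|By]; first by rewrite sA => /hK[hx _] ->.
by have [Ay ey] := kK y By; exists (k y); rewrite ?sA.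
Qed.

Lemma enumerates_cat (T : eqType) (s t : seq T) (A B C : pred T) :
  enumerates s A -> enumerates t B -> (forall x, A x -> ~~ B x) ->
  C =1 predU A B -> enumerates (s ++ t) C.
Proof.
move=> [us sA] [ut tB] AB eC; split=> [|x]; last by rewrite mem_cat sA tB [RHS]eC.
rewrite cat_uniq us ut andbT; apply/hasPn => x; rewrite sA tB => Bx.
by apply: contraTN Bx => /AB.
Qed.

Definition fibre (T : eqType) (P : pred T) (w : T -> nat) (n : nat) : pred T :=
  [pred x | P x & w x == n].

Section GeneratingSeries.
Variable R : comNzRingType.

Definition generates (T : eqType) (P : pred T) (w : T -> nat) (f : series R) : Prop :=
  forall n, exists s : seq T, enumerates s (fibre P w n) /\ f n = (size s)%:R.

Lemma generates_coef (T : eqType) (P : pred T) w f n s :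
  generates P w f -> enumerates s (fibre P w n) -> f n = (size s)%:R.
Proof. by move=> /(_ n)[t [ht ->]] hs; rewrite (enumerates_size ht hs). Qed.

Lemma generates_coef0 (T : eqType) (P : pred T) w f n :
  generates P w f -> (forall x, P x -> w x <> n) -> f n = 0.
Proof.
move=> fP Pn; rewrite (generates_coef (s := [::]) fP) //; split=> // x.
by rewrite !inE; case: (boolP (P x)) => //= /Pn /eqP /negbTE ->.
Qed.

Lemma generates_coef_bij (T U : eqType) (P : pred T) (Q : pred U) w v f g n m
    (h : T -> U) (k : U -> T) :
  generates P w f -> generates Q v g ->
  {in fibre P w n, forall x, fibre Q v m (h x) /\ k (h x) = x} ->
  {in fibre Q v m, forall y, fibre P w n (k y) /\ h (k y) = y} ->
  f n = g m.
Proof.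
move=> /(_ n)[s [hs ->]] gQ hK kK.
by rewrite (generates_coef gQ (enumerates_map hK kK hs)) size_map.
Qed.

Lemma generates_bij (T U : eqType) (P : pred T) (Q : pred U) w v f
    (h : T -> U) (k : U -> T) :
  (forall x, P x -> [/\ Q (h x), v (h x) = w x & k (h x) = x]) ->
  (forall y, Q y -> [/\ P (k y), w (k y) = v y & h (k y) = y]) ->
  generates P w f -> generates Q v f.
Proof.
move=> hK kK fP n; have [s [hs ->]] := fP n; exists (map h s); rewrite size_map.
split=> //; apply: (enumerates_map (k := k)) hs => [x|y] /andP[/= px /eqP <-].
  by have [qx vx ex] := hK x px; rewrite /fibre /= qx vx eqxx.
by have [py wy ey] := kK y px; rewrite /fibre /= py wy eqxx.
Qed.

Lemma generates_dilate (T : eqType) (P : pred T) w f p : (0 < p)%N ->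
  generates P w f -> generates P (fun x => p * w x)%N (dilate p f).
Proof.
move=> p0 fP n /=; case: ifP => [/dvdnP[m ->]|pn].
  rewrite mulnK //; have [s [[us sP] fm]] := fP m; exists s; split=> //.
  by split=> // x; rewrite sP !inE /= mulnC eqn_pmul2r.
exists [::]; split=> //; split=> // x; rewrite !inE; apply/esym/andP => -[_ /eqP wx].
by rewrite -wx dvdn_mulr in pn.
Qed.

Lemma generatesM (T U : eqType) (P : pred T) (Q : pred U) w v f g :
  generates P w f -> generates Q v g ->
  generates [pred u : T * U | P u.1 & Q u.2] (fun u => w u.1 + v u.2)%N (f * g).
Proof.
move=> /boolp.choice[s sP] /boolp.choice[t tQ] n.
have us i : uniq (s i) by have [[]] := sP i.
have ut i : uniq (t i) by have [[]] := tQ i.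
have mems i x : (x \in s i) = P x && (w x == i) by have [[_ ->]] := sP i.
have memt i y : (y \in t i) = Q y && (v y == i) by have [[_ ->]] := tQ i.
pose st i := [seq (x, y) | x <- s i, y <- t (n - i)%N].
exists [seq u | i <- index_iota 0 n.+1, u <- st i]; split; last first.
  rewrite size_allpairs_dep sumnE big_map natr_sum coef_seriesM.
  rewrite big_mkord; apply: eq_bigr => i _.
  by rewrite size_allpairs natrM; have [_ ->] := sP i; have [_ ->] := tQ (n - i)%N.
split; first apply: allpairs_uniq_dep; rewrite ?iota_uniq //.
- by move=> i _; rewrite allpairs_uniq // => -[x y] [x' y'] _ _ [-> ->].
- move=> _ _ /allpairsPdep[i [u [_ iu ->]]] /allpairsPdep[j [u' [_ ju ->]]] /= e.
  have w1 k z : z \in st k -> w z.1 = k.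
    by case/allpairsP=> -[x y] [/=]; rewrite mems => /andP[_ /eqP wx] _ ->.
  by rewrite e in iu *; rewrite -(w1 _ _ iu) (w1 _ _ ju).
move=> [x y]; rewrite inE.
apply/allpairsPdep/andP => /= [[i [u [ltin iu e]]]|[/andP[px qy] /eqP wv]].
  case/allpairsP: iu e => -[x' y'] [/=]; rewrite mems memt mem_index_iota in ltin *.
  move=> /andP[px /eqP wx] /andP[qy /eqP vy] -> [-> ->].
  by rewrite px qy wx vy subnKC //; lia.
exists (w x), (x, y); split=> //.
  by rewrite mem_index_iota ltnS -wv leq_addr.
by apply/allpairsP; exists (x, y); rewrite /= mems memt px qy -wv addKn !eqxx.
Qed.

End GeneratingSeries.

Lemma generates_involution (T : eqType) (P : pred T) w (f : series 'F_2) n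
    (h : T -> T) (s : seq T) :
  generates P w f ->
  {in fibre P w n, forall x, fibre P w n (h x) /\ h (h x) = x} ->
  enumerates s [pred x | fibre P w n x & h x == x] -> f n = (size s)%:R.
Proof.
move=> /(_ n)[t [[ut tP] ->]] hP hs.
have sizeE (r : seq T) : (size r)%:R = \sum_(x <- r) 1 :> 'F_2.
  by rewrite -sum1_size natr_sum.
have ft : enumerates [seq x <- t | h x == x] [pred x | fibre P w n x & h x == x].
  by split=> [|x]; rewrite ?filter_uniq // mem_filter tP andbC.
rewrite -(enumerates_size ft hs) !sizeE big_filter; apply: big_involution => //.
- by move=> _; rewrite mulr2n (addrr_pchar2 pchar_F2).
- by move=> x; rewrite !tP => /hP[].
- by move=> x; rewrite tP => /hP[].
Qed.

Lemma generates_involution0 (T : eqType) (P : pred T) w (f : series 'F_2) n (h : T -> T) :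
  generates P w f ->
  {in fibre P w n, forall x, [/\ fibre P w n (h x), h (h x) = x & h x != x]} ->
  f n = 0.
Proof.
move=> fP hP; apply: (generates_involution (h := h) (s := [::]) fP) => [x /hP[]|] //.
split=> // x; rewrite !inE; apply/esym/negP => /andP[hx /eqP ex].
by have [_ _ /eqP] := hP x hx.
Qed.

Lemma coprime6E m : coprime m 6 = (m %% 6 == 1)%N || (m %% 6 == 5)%N.
Proof.
rewrite /coprime -gcdn_modl; have := ltn_pmod m (isT : 0 < 6)%N.
by case: (m %% 6)%N => [|[|[|[|[|[|]]]]]].
Qed.

Lemma generates_D : generates (fun m => coprime m 6) (fun m => m ^ 2)%N D.
Proof.
move=> n; exists [seq m <- index_iota 0 n.+1 | coprime m 6 && (m ^ 2 == n)%N].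
split.
  split=> [|m]; first by rewrite filter_uniq ?iota_uniq.
  rewrite mem_filter mem_index_iota /fibre inE /=.
  by case: eqP => [<-|]; rewrite ?andbF // andbT; case: (coprime _ _) => //=; nia.
rewrite -sum1_size natr_sum big_filter big_mkord; apply: eq_bigl => -[m mn] /=.
by case: m mn.
Qed.

Lemma hecke_D p : prime p -> coprime p 6 -> hecke p D = 0.
Proof.
move=> pp p6; have p0 := prime_gt0 pp.
apply: seriesP => n; change (D (p * n)%N + dilate p D n = 0).
suff -> : D (p * n)%N = dilate p D n by rewrite (addrr_pchar2 pchar_F2).
apply: (generates_coef_bij (h := divn^~ p) (k := muln p)
  generates_D (generates_dilate p0 generates_D)) => m /andP[/= cm /eqP em].
  have /dvdnP[l ml] : (p %| m)%N.
    by have : (p %| m ^ 2)%N by [rewrite em dvdn_mulr]; rewrite Euclid_dvdX // => /andP[].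
  move: cm em; rewrite ml coprimeMl => /andP[cl _] el.
  rewrite mulnK // mulnC /fibre /= cl -(eqn_pmul2l p0) -el; split=> //.
  by apply/eqP; ring.
rewrite mulKn // /fibre /= coprimeMl p6 cm -em; split=> //.
by apply/eqP; ring.
Qed.

(** * Pairs of given norm in Z[sqrt(-7)] *)

Definition one_mod6 (m : int) : bool := (m %% 6)%Z == 1.

Lemma generates_D_int : generates one_mod6 (fun m : int => `|m| ^ 2)%N D.
Proof.
apply: (generates_bij (h := fun m : nat => if (m %% 6 == 1)%N then m%:Z else - m%:Z)
  (k := absz)) generates_D => m; rewrite coprime6E /one_mod6.
  by case: ifP => /= m1 m5; split; lia.
by move=> m1; case: ifP => m6; split; lia.
Qed.

Definition one_mod6_pair : pred (int * int) := [pred u | one_mod6 u.1 & one_mod6 u.2].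

Definition norm7 (u : int * int) : nat := (`|u.1| ^ 2 + 7 * `|u.2| ^ 2)%N.

Lemma generates_norm7 : generates one_mod6_pair norm7 (D * dilate 7 D).
Proof. exact: generatesM generates_D_int (generates_dilate _ generates_D_int). Qed.

Lemma sqr_one_mod6 (m : int) : one_mod6 m -> (`|m| ^ 2 %% 24 = 1)%N.
Proof.
move=> /eqP m1; have [x [->|->]] : exists x, m = 12 * x + 1 \/ m = 12 * x + 7.
  by exists (m %/ 12)%Z; lia.
- by have : (12 * x + 1) ^+ 2 = 24 * (6 * x ^+ 2 + x) + 1 by [ring]; lia.
- by have : (12 * x + 7) ^+ 2 = 24 * (6 * x ^+ 2 + 7 * x + 2) + 1 by [ring]; lia.
Qed.

Lemma norm7_mod24 u : one_mod6_pair u -> (norm7 u %% 24 = 8)%N.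
Proof. by case/andP=> /sqr_one_mod6 m1 /sqr_one_mod6 n1; rewrite /norm7; lia. Qed.

Lemma norm7E u : (norm7 u)%:Z = u.1 ^+ 2 + 7 * u.2 ^+ 2.
Proof. by rewrite /norm7; lia. Qed.

Lemma norm7_mod16 (n c : int) : ~~ (2 %| n)%Z ->
  (norm7 (n + 8 * c, n)%R %% 16 = 8)%N.
Proof.
move=> on; have [y ->] : exists y, n = 2 * y + 1 by exists (n %/ 2)%Z; lia.
have : (norm7 (2 * y + 1 + 8 * c, 2 * y + 1))%:Z =
    8 + 16 * (2 * y ^+ 2 + 2 * y + (2 * y + 1) * c + 4 * c ^+ 2).
  by rewrite norm7E /=; ring.
by move: (norm7 _) (_ + 4 * _) => N t; lia.
Qed.

Lemma norm7_mod32 (n k : int) : ~~ (2 %| n)%Z ->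
  (norm7 (3 * n + 8 * k, n)%R %% 32 = if (2 %| k)%Z then 16 else 0)%N.
Proof.
move=> on; have [y ->] : exists y, n = 2 * y + 1 by exists (n %/ 2)%Z; lia.
have : (norm7 (3 * (2 * y + 1) + 8 * k, 2 * y + 1))%:Z =
    16 * (1 + k) + 32 * (2 * y ^+ 2 + 2 * y + 3 * y * k + k + 2 * k ^+ 2).
  by rewrite norm7E /=; ring.
by move: (norm7 _) (_ + 2 * k ^+ 2) => N t; case: ifP => ?; lia.
Qed.

Lemma norm7N u : norm7 (- u.1, u.2) = norm7 u.
Proof. by rewrite /norm7 /= abszN. Qed.

Lemma norm7_cases m n : one_mod6_pair (m, n) ->
  (exists2 c : int, m = n + 8 * c \/ m = 8 * c - n & (norm7 (m, n) %% 16 = 8)%N) \/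
  (exists2 k : int, m = 3 * n + 8 * k \/ m = 8 * k - 3 * n &
    (norm7 (m, n) %% 32 = if (2 %| k)%Z then 16 else 0)%N).
Proof.
rewrite /one_mod6_pair /one_mod6 /= => mn1; have on : ~~ (2 %| n)%Z by lia.
have /orP[/orP[]|/orP[]] : ((8 %| m - n) || (8 %| m + n))%Z
    || ((8 %| m - 3 * n) || (8 %| m + 3 * n))%Z by lia.
- case/dvdzP=> c ec; have -> : m = n + 8 * c by lia.
  by left; exists c; [left|apply: norm7_mod16].
- case/dvdzP=> c ec; have -> : m = - (n + 8 * - c) by lia.
  left; exists c; first by right; lia.
  by rewrite (norm7N (_, n)) norm7_mod16.
- case/dvdzP=> k ek; have -> : m = 3 * n + 8 * k by lia.
  by right; exists k; [left|apply: norm7_mod32].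
- case/dvdzP=> k ek; have -> : m = - (3 * n + 8 * - k) by lia.
  right; exists k; first by right; lia.
  by rewrite (norm7N (_, n)) norm7_mod32 // rpredN.
Qed.

Lemma norm7_eqM (r : nat) u v :
  u.1 ^+ 2 + 7 * u.2 ^+ 2 = r%:Z * (v.1 ^+ 2 + 7 * v.2 ^+ 2) -> norm7 u = (r * norm7 v)%N.
Proof. by rewrite -!norm7E -PoszM => -[]. Qed.

Lemma norm7_eq u v :
  u.1 ^+ 2 + 7 * u.2 ^+ 2 = v.1 ^+ 2 + 7 * v.2 ^+ 2 -> norm7 u = norm7 v.
Proof. by move=> uv; rewrite -[RHS]mul1n; apply: norm7_eqM; rewrite mul1r. Qed.

(* Let pi = (1 + sqrt(-7)) / 2, so that 2 = pi pi' with ' denoting conjugation. Then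
   refl8 maps z = m + n sqrt(-7) to z' pi / pi' if m = n mod 8, and to - z' pi' / pi if
   m = - n mod 8. The signs keep both coordinates 1 mod 6. *)
Definition refl8 (u : int * int) : int * int :=
  if (8 %| u.1 - u.2)%Z
  then let c := ((u.1 - u.2) %/ 8)%Z in (u.2 - 6 * c, u.2 + 2 * c)
  else let c := ((u.1 + u.2) %/ 8)%Z in (14 * c - u.1, u.1 - 6 * c).

Lemma refl8_sub n c : refl8 (n + 8 * c, n) = (n - 6 * c, n + 2 * c).
Proof. by rewrite /refl8 /=; case: ifP => h; congr (_, _); lia. Qed.

Lemma refl8_add m c : ~~ (2 %| m)%Z -> refl8 (m, 8 * c - m) = (14 * c - m, m - 6 * c).
Proof. by rewrite /refl8 /= => om; case: ifP => h; congr (_, _); lia. Qed.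

Lemma refl8P u : one_mod6_pair u -> (norm7 u %% 16 = 8)%N ->
  [/\ one_mod6_pair (refl8 u), norm7 (refl8 u) = norm7 u, refl8 (refl8 u) = u &
      (refl8 u == u) = (u.1 == u.2) || (u.1 == 7 * u.2)].
Proof.
case: u => m n u1 N8; have [[c mc _]|[k _]] := norm7_cases u1; last by case: ifP; lia.
move: u1; rewrite /one_mod6_pair /one_mod6 /= => mn1.
case: mc => em; [|have {}em : n = 8 * c - m by lia]; subst.
- rewrite refl8_sub; split; rewrite ?xpair_eqE /=; try lia.
  + by apply: norm7_eq => /=; ring.
  + have -> : n - 6 * c = (n + 2 * c) + 8 * - c by ring.
    by rewrite refl8_sub; congr (_, _); ring.
- rewrite refl8_add; last by lia.
  split; rewrite ?xpair_eqE /=; try lia.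
  + by apply: norm7_eq => /=; ring.
  + have -> : m - 6 * c = 8 * c - (14 * c - m) by ring.
    by rewrite refl8_add; [congr (_, _); ring|lia].
Qed.

(* z is mapped to - z (pi / pi')^2 if m = 3 n mod 8, and to - z (pi' / pi)^2 if
   m = - 3 n mod 8; this exchanges the two cases. *)
Definition refl16 (u : int * int) : int * int :=
  if (8 %| u.1 - 3 * u.2)%Z
  then let k := ((u.1 - 3 * u.2) %/ 8)%Z in (- (3 * u.2 + k), u.2 + 3 * k)
  else let k := ((u.1 + 3 * u.2) %/ 8)%Z in (3 * u.2 - k, u.2 - 3 * k).

Lemma refl16_sub n k : refl16 (3 * n + 8 * k, n) = (- (3 * n + k), n + 3 * k).
Proof. by rewrite /refl16 /=; case: ifP => h; congr (_, _); lia. Qed.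

Lemma refl16_add n k : ~~ (2 %| n)%Z ->
  refl16 (8 * k - 3 * n, n) = (3 * n - k, n - 3 * k).
Proof. by rewrite /refl16 /= => on; case: ifP => h; congr (_, _); lia. Qed.

Lemma refl16P u : one_mod6_pair u -> (norm7 u %% 32 = 16)%N ->
  [/\ one_mod6_pair (refl16 u), norm7 (refl16 u) = norm7 u, refl16 (refl16 u) = u &
      refl16 u != u].
Proof.
case: u => m n u1 N16; have [[c _]|[k mk]] := norm7_cases u1; first by lia.
rewrite N16; case: ifP => // k2 _.
move: u1; rewrite /one_mod6_pair /one_mod6 /= => mn1.
case: mk => em; subst.
- rewrite refl16_sub; split; rewrite ?xpair_eqE /=; try lia.
  + by apply: norm7_eq => /=; ring.
  + have -> : - (3 * n + k) = 8 * k - 3 * (n + 3 * k) by ring.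
    by rewrite refl16_add; [congr (_, _); ring|lia].
- rewrite refl16_add; last by lia.
  split; rewrite ?xpair_eqE /=; try lia.
  + by apply: norm7_eq => /=; ring.
  + have -> : 3 * n - k = 3 * (n - 3 * k) + 8 * k by ring.
    by rewrite refl16_sub; congr (_, _); ring.
Qed.

(* z is mapped to z' / pi^2 if m = 3 n mod 8, and to - z' / pi'^2 if m = - 3 n mod 8. *)
Definition quarter_norm (u : int * int) : int * int :=
  if (8 %| u.1 - 3 * u.2)%Z
  then let k := ((u.1 - 3 * u.2) %/ 8)%Z in (- (2 * u.2 + 3 * k), - k)
  else let k := ((u.1 + 3 * u.2) %/ 8)%Z in (3 * k - 2 * u.2, - k).

Definition quadruple_norm (v : int * int) : int * int :=
  if (4 %| v.1 - v.2)%Z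
  then let n := ((3 * v.2 - v.1) %/ 2)%Z in (3 * n - 8 * v.2, n)
  else let n := ((v.1 + 3 * v.2) %/ 2)%Z in (3 * n - 8 * v.2, - n).

Lemma quarter_norm_sub n k : quarter_norm (3 * n + 8 * k, n) = (- (2 * n + 3 * k), - k).
Proof. by rewrite /quarter_norm /=; case: ifP => h; congr (_, _); lia. Qed.

Lemma quarter_norm_add n k : ~~ (2 %| n)%Z ->
  quarter_norm (8 * k - 3 * n, n) = (3 * k - 2 * n, - k).
Proof. by rewrite /quarter_norm /= => on; case: ifP => h; congr (_, _); lia. Qed.

Lemma quadruple_norm_sub n k : ~~ (2 %| n)%Z -> ~~ (2 %| k)%Z ->
  quadruple_norm (- (2 * n + 3 * k), - k) = (3 * n + 8 * k, n).
Proof. by rewrite /quadruple_norm /= => on ok; case: ifP => h; congr (_, _); lia. Qed.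

Lemma quadruple_norm_add n k : ~~ (2 %| n)%Z -> ~~ (2 %| k)%Z ->
  quadruple_norm (3 * k - 2 * n, - k) = (8 * k - 3 * n, n).
Proof. by rewrite /quadruple_norm /= => on ok; case: ifP => h; congr (_, _); lia. Qed.

Lemma quarter_normP u : one_mod6_pair u -> (norm7 u %% 32 = 0)%N ->
  [/\ one_mod6_pair (quarter_norm u), (norm7 u = 4 * norm7 (quarter_norm u))%N &
      quadruple_norm (quarter_norm u) = u].
Proof.
case: u => m n u1 N0; have [[c _]|[k mk]] := norm7_cases u1; first by lia.
rewrite N0; case: ifP => // k2 _.
move: u1; rewrite /one_mod6_pair /one_mod6 /= => mn1.
case: mk => em; subst.
- rewrite quarter_norm_sub quadruple_norm_sub; try lia.
  split=> //=; first by lia.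
  by apply: norm7_eqM => /=; ring.
- rewrite quarter_norm_add ?quadruple_norm_add; try lia.
  split=> //=; first by lia.
  by apply: norm7_eqM => /=; ring.
Qed.

Lemma quadruple_normP v : one_mod6_pair v ->
  [/\ one_mod6_pair (quadruple_norm v), norm7 (quadruple_norm v) = (4 * norm7 v)%N &
      quarter_norm (quadruple_norm v) = v].
Proof.
case: v => m k; rewrite /one_mod6_pair /one_mod6 /= => mk1.
have [h|h] : (4 %| m - k)%Z \/ (4 %| m + k)%Z by lia.
- have [n em] : exists n, m = - (2 * n + 3 * - k) by exists ((3 * k - m) %/ 2)%Z; lia.
  subst; have := @quadruple_norm_sub n (- k); rewrite opprK => ->; try lia.
  rewrite quarter_norm_sub opprK; split=> //=; first by lia.
  by apply: norm7_eqM => /=; ring.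
- have [n em] : exists n, m = 3 * - k - 2 * n by exists ((- m - 3 * k) %/ 2)%Z; lia.
  subst; have := @quadruple_norm_add n (- k); rewrite opprK => ->; try lia.
  rewrite quarter_norm_add ?opprK; try lia.
  split=> //=; first by lia.
  by apply: norm7_eqM => /=; ring.
Qed.

(** * The modular equation *)

Lemma enumerates_multiples (r : int) N (s : seq int) : one_mod6 r ->
  enumerates s (fibre one_mod6 (fun k => (`|r| ^ 2 + 7) * `|k| ^ 2)%N N) ->
  enumerates [seq (r * k, k) | k <- s]
    [pred u | fibre one_mod6_pair norm7 N u & u.1 == r * u.2].
Proof.
move=> /eqP r1; have rk1 k : one_mod6 (r * k) = one_mod6 k.
  by rewrite /one_mod6 -modzMml r1 mul1r.
have rkN k : norm7 (r * k, k) = ((`|r| ^ 2 + 7) * `|k| ^ 2)%N.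
  by rewrite /norm7 /= abszM expnMn mulnDl.
apply: (enumerates_map (k := snd)) => [k|[m k]].
  by rewrite /fibre /one_mod6_pair !inE /= rk1 rkN eqxx => /andP[-> ->].
rewrite /fibre /one_mod6_pair !inE /= => /andP[/andP[/andP[_ k1] mkN] /eqP mE].
by rewrite k1 -rkN -mE.
Qed.

Lemma coef_D_dilate7_8mod16 N : (N %% 16 = 8)%N ->
  (D * dilate 7 D) N = dilate 8 D N + dilate 56 D N.
Proof.
move=> N8.
have [s [sP ->]] := generates_dilate (isT : 0 < 8)%N generates_D_int N.
have [t [tP ->]] := generates_dilate (isT : 0 < 56)%N generates_D_int N.
have sD := enumerates_multiples (isT : one_mod6 1) sP.
have tD := enumerates_multiples (isT : one_mod6 7) tP.
rewrite -natrD -(size_map (fun k => (1 * k, k)) s) -(size_map (fun k => (7 * k, k)) t).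
rewrite -size_cat; apply: (generates_involution (h := refl8) generates_norm7).
  move=> u /andP[/= u1 /eqP uN]; rewrite -uN in N8 *.
  by have [v1 vN -> _] := refl8P u1 N8; rewrite /fibre /= v1 vN eqxx.
apply: (enumerates_cat sD tD) => u.
  by case: u => m n; rewrite /fibre /one_mod6_pair /one_mod6 /=; lia.
rewrite /= -andb_orr mul1r; case: (boolP (fibre _ _ _ u)) => //= /andP[/= u1 /eqP uN].
by rewrite -uN in N8; have [_ _ _ ->] := refl8P u1 N8.
Qed.

Lemma coef_D_dilate7_16mod32 N : (N %% 32 = 16)%N -> (D * dilate 7 D) N = 0.
Proof.
move=> N16; apply: (generates_involution0 (h := refl16) generates_norm7) => u.
case/andP=> /= u1 /eqP uN; rewrite -uN in N16 *.
by have [v1 vN ? ?] := refl16P u1 N16; rewrite /fibre /= v1 vN eqxx.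
Qed.

Lemma coef_D_dilate7_0mod32 N : (N %% 32 = 0)%N ->
  (D * dilate 7 D) N = (D * dilate 7 D) (N %/ 4)%N.
Proof.
move=> N0; apply: (generates_coef_bij (h := quarter_norm) (k := quadruple_norm)
  generates_norm7 generates_norm7) => u /andP[/= u1 /eqP uN].
  rewrite -uN in N0 *; have [v1 -> vK] := quarter_normP u1 N0.
  by rewrite /fibre /= v1 mulKn // eqxx.
have [v1 vN vK] := quadruple_normP u1; rewrite /fibre /= v1 vN uN vK; split=> //.
by apply/eqP; lia.
Qed.

Lemma modular_equation :
  D ^+ 8 + dilate 7 D ^+ 8 + D * dilate 7 D + (D * dilate 7 D) ^+ 4 = 0.
Proof.
rewrite (series_exp2 _ 3) (series_exp2 _ 3) (series_exp2 _ 2) dilate_dilate //.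
set E := D * _; apply: seriesP => N.
change (dilate 8 D N + dilate 56 D N + E N + dilate 4 E N = 0).
have addrr := addrr_pchar2 pchar_F2.
have E0 n : (n %% 24 != 8)%N -> E n = 0.
  move=> /eqP n8; apply: (generates_coef0 generates_norm7) => u /norm7_mod24 + un.
  by rewrite un.
have dilateE0 n : (n %% 32 != 0)%N -> dilate 4 E n = 0.
  by rewrite coef_dilate => n0; case: ifP => // n4; rewrite E0 //; lia.
have dilateD0 p : (p = 8 \/ p = 56)%N -> (N %% 16 != 8)%N -> dilate p D N = 0.
  move=> p8 /eqP N8; apply: (generates_coef0 (generates_dilate _ generates_D_int)).
    by lia.
  by move=> m /sqr_one_mod6; move: (_ ^ 2)%N => x; lia.
have [N8|N8] := eqVneq (N %% 16)%N 8%N.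
  by rewrite -coef_D_dilate7_8mod16 // addrr dilateE0 ?addr0 //; lia.
rewrite !dilateD0 ?addr0 ?add0r //; try by [left|right].
have [N16|N16] := eqVneq (N %% 32)%N 16%N.
  by rewrite coef_D_dilate7_16mod32 // dilateE0 ?addr0 //; lia.
have [N0|N0] := eqVneq (N %% 32)%N 0%N; last first.
  by rewrite dilateE0 // E0 ?addr0 //; lia.
by rewrite coef_D_dilate7_0mod32 // coef_dilate (_ : 4 %| N)%N ?addrr //; lia.
Qed.

Lemma modular_equation24 :
  D ^+ 24 + dilate 7 D ^+ 24 + D ^+ 3 * dilate 7 D ^+ 3 + D ^+ 6 * dilate 7 D ^+ 6 = 0.
Proof.
have := modular_equation; move: D (dilate 7 D) => X Y /eqP.
rewrite -addrA addr_eq0 (oppr_pchar2 pchar_series) => /eqP; set C := X * Y => XY.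
transitivity ((X ^+ 8 + Y ^+ 8) ^+ 3 - 3 * C ^+ 8 * (X ^+ 8 + Y ^+ 8) + C ^+ 3 + C ^+ 6).
  by rewrite /C; ring.
rewrite XY -(addrr_pchar2 pchar_series (C ^+ 3 + 2 * C ^+ 6 - C ^+ 12)).
by ring.
Qed.

(** * Hecke operators *)

Lemma heckeE p f : hecke p f = decimate p f + dilate p f.
Proof. exact: seriesP. Qed.

Lemma hecke_exp2 p f j : odd p -> hecke p (f ^+ (2 ^ j)) = hecke p f ^+ (2 ^ j).
Proof.
move=> op; have p0 : (0 < p)%N by case: p op.
have j0 : (0 < 2 ^ j)%N by rewrite expn_gt0.
rewrite !series_exp2 !heckeE dilateD !dilate_dilate // mulnC decimate_dilate //.
by rewrite coprimeXr // coprimen2.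
Qed.

Lemma mul_hecke_exp p (f : series 'F_2) i j n : (0 < p)%N ->
  f ^+ i * hecke p (f ^+ (n + j)) =
  decimate p (f ^+ n * (f ^+ j * dilate p f ^+ i)) +
  dilate p f ^+ n * (f ^+ i * dilate p f ^+ j).
Proof.
move=> p0; rewrite heckeE mulrDr -decimate_dilateM // !dilateX // exprD.
by congr (_ + _); [congr decimate|rewrite exprD]; ring.
Qed.

(* The second term of mul_hecke_exp is the first one with f and its dilation
   exchanged, so a relation symmetric in both annihilates the sum. *)
Lemma hecke_relation p (f : series 'F_2) (s : seq (nat * nat)) n : (0 < p)%N ->
  \sum_(u <- s) f ^+ u.1 * dilate p f ^+ u.2 = 0 ->
  \sum_(u <- s) f ^+ u.2 * dilate p f ^+ u.1 = 0 ->
  \sum_(u <- s) f ^+ u.1 * hecke p (f ^+ (n + u.2)) = 0.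
Proof.
move=> p0 r1 r2; under eq_bigr do rewrite mul_hecke_exp //.
rewrite big_split /= -mulr_sumr r1 mulr0 addr0.
rewrite -(big_morph _ (@decimateD _ p) (decimate0 _ p)) -mulr_sumr r2 mulr0.
exact: decimate0.
Qed.

Lemma hecke_recurrence p (f : series 'F_2) a b c k n : (0 < p)%N ->
  f ^+ a + dilate p f ^+ a + f ^+ b * dilate p f ^+ b
    + f ^+ c * dilate p f ^+ c = 0 ->
  let q := (2 ^ k)%N in
  hecke p (f ^+ (n + a * q)) = f ^+ (a * q) * hecke p (f ^+ n)
  + f ^+ (b * q) * hecke p (f ^+ (n + b * q)) + f ^+ (c * q) * hecke p (f ^+ (n + c * q)).
Proof.
move=> p0 rel q; have relq : f ^+ (a * q) + dilate p f ^+ (a * q)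
    + f ^+ (b * q) * dilate p f ^+ (b * q) + f ^+ (c * q) * dilate p f ^+ (c * q) = 0.
  rewrite !exprM -(exprMn _ (f ^+ b)) -(exprMn _ (f ^+ c)) !series_exp2 -!dilateD rel.
  by rewrite -series_exp2 expr0n expn_eq0.
apply/eqP; rewrite -[_ == _]subr_eq0 (oppr_pchar2 pchar_series).
have := @hecke_relation p f
  [:: (0, a * q); (a * q, 0); (b * q, b * q); (c * q, c * q)]%N n p0.
rewrite !big_cons !big_nil /= !expr0 !mul1r !mulr1 !addr0 addn0 -!addrA => -> //.
  by rewrite addrCA !addrA.
by rewrite !addrA.
Qed.

Lemma hecke7_rec8 n : hecke 7 (D ^+ (n + 8)) =
  D ^+ 8 * hecke 7 (D ^+ n) + D * hecke 7 (D ^+ (n + 1))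
  + D ^+ 4 * hecke 7 (D ^+ (n + 4)).
Proof.
apply: (@hecke_recurrence 7 D 8 1 4 0) => //.
by rewrite !expr1 -exprMn modular_equation.
Qed.

Lemma hecke7_rec24 k n : let q := (2 ^ k)%N in
  hecke 7 (D ^+ (n + 24 * q)) = D ^+ (24 * q) * hecke 7 (D ^+ n)
  + D ^+ (3 * q) * hecke 7 (D ^+ (n + 3 * q)) + D ^+ (6 * q) * hecke 7 (D ^+ (n + 6 * q)).
Proof. exact: hecke_recurrence modular_equation24. Qed.

(** * Initial values *)

Lemma low_vanishing_D : low_vanishing 1 D.
Proof. by case=> // _; rewrite /= big_pred0 // => -[[|[]]]. Qed.

Lemma D_coef1 : D 1%N = 1.
Proof. by rewrite /= big_mkcond !big_ord_recl big_ord0 /= addr0 add0r. Qed.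

Lemma hecke7_D_exp2 k : hecke 7 (D ^+ (2 ^ k)) = 0.
Proof. by rewrite hecke_exp2 // hecke_D // expr0n expn_eq0. Qed.

Lemma hecke7_sqr n : hecke 7 (D ^+ (n * 2)) = hecke 7 (D ^+ n) ^+ 2.
Proof. by rewrite exprM (@hecke_exp2 7 _ 1). Qed.

Lemma hecke7_D5_eq : D * hecke 7 (D ^+ 5) = hecke 7 (D ^+ 3) ^+ 4.
Proof.
have := hecke7_rec8 4; rewrite (hecke7_D_exp2 2) (hecke7_D_exp2 3).
by rewrite !mulr0 add0r addr0 (hecke7_sqr 6) (hecke7_sqr 3) -exprM => <-.
Qed.

(* If x^v were the lowest term of T_7(D^3), then f8 below would equate a series of
   order 8 v to one of order v + 3. *)
Lemma hecke7_D3 : hecke 7 (D ^+ 3) = 0.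
Proof.
have h10 : hecke 7 (D ^+ 5) ^+ 2 = D * hecke 7 (D ^+ 3) + D ^+ 4 * hecke 7 (D ^+ 3) ^+ 2.
  by rewrite -!hecke7_sqr (hecke7_rec8 2) (hecke7_D_exp2 1) mulr0 add0r.
have : hecke 7 (D ^+ 3) ^+ 8 = D ^+ 3 * hecke 7 (D ^+ 3) + D ^+ 6 * hecke 7 (D ^+ 3) ^+ 2.
  by rewrite (exprM _ 4 2) -hecke7_D5_eq exprMn h10; ring.
move: (hecke 7 _) => f f8; apply: low_vanishing_eq0 => v fv.
have D3 := low_vanishingX (n := 3) low_vanishing_D.
have D6 := low_vanishingX (n := 6) low_vanishing_D.
have D6f2 := low_vanishingM D6 (low_vanishingX (n := 2) fv).
have := lowest_coefM D3 fv.
rewrite lowest_coefX ?D_coef1 ?expr1n ?mul1r; last exact: low_vanishing_D.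
have -> : D ^+ 3 * f = dilate 8 f + D ^+ 6 * f ^+ 2.
  by rewrite -(series_exp2 f 3) f8 -addrA (addrr_pchar2 pchar_series) addr0.
move=> <-; rewrite coef_seriesD coef_dilate D6f2 ?addr0; last by lia.
by case: ifP => // d8; apply: fv; lia.
Qed.

Lemma hecke7_D5 : hecke 7 (D ^+ 5) = 0.
Proof.
apply: (mul_series_eq0 low_vanishing_D); first by rewrite D_coef1 oner_eq0.
by rewrite hecke7_D5_eq hecke7_D3 expr0n.
Qed.

Lemma hecke7_D7 : hecke 7 (D ^+ 7) = D.
Proof.
have h14 : hecke 7 (D ^+ 7) * (hecke 7 (D ^+ 7) + D) = 0.
  have := hecke7_rec8 6; rewrite (hecke7_sqr 3) (hecke7_sqr 5) (hecke7_sqr 7).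
  rewrite hecke7_D3 hecke7_D5 !expr0n !mulr0 add0r addr0 => e.
  by rewrite mulrDr -expr2 e mulrC (addrr_pchar2 pchar_series).
apply/eqP; rewrite -subr_eq0 (oppr_pchar2 pchar_series); apply/eqP.
apply: (mul_series_eq0 (a := 1)) h14 => [[|//] _|].
  exact: addrr_pchar2 pchar_F2 _.
change ((D ^+ 7) (7 * 1)%N + 0 != 0).
by rewrite addr0 lowest_coefX ?D_coef1 ?expr1n //; exact: low_vanishing_D.
Qed.

(* Together with T 5 = 0, these are the values at 5 + 6 m for m < 8. *)
Lemma small_values_of_recurrences (R : comNzRingType) (X : R) (T : nat -> R) :
  2 \in [pchar R] ->
  (forall n, T (n * 2)%N = T n ^+ 2) ->
  (forall n, T (n + 8)%N = X ^+ 8 * T n + X * T (n + 1)%N + X ^+ 4 * T (n + 4)%N) ->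
  (forall n,
     T (n + 24)%N = X ^+ 24 * T n + X ^+ 3 * T (n + 3)%N + X ^+ 6 * T (n + 6)%N) ->
  T 1%N = 0 -> T 3%N = 0 -> T 5%N = 0 -> T 7%N = X ->
  [/\ T 11%N = X ^+ 5, T 17%N = 0 & T 23%N = X ^+ 17] /\
  [/\ T 29%N = X ^+ 11, T 35%N = X ^+ 29 + X ^+ 5, T 41%N = X ^+ 23
    & T 47%N = X ^+ 41 + X ^+ 17].
Proof.
move=> char2 sqr rec8 rec24 T1 T3 T5 T7.
have sqr0 n : T n = 0 -> T (n * 2)%N = 0 by move=> Tn; rewrite sqr Tn expr0n.
have T2 := sqr0 1%N T1; have T4 := sqr0 2%N T2; have T8 := sqr0 4%N T4.
have T16 := sqr0 8%N T8; have T6 := sqr0 3%N T3; have T12 := sqr0 6%N T6.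
have T10 := sqr0 5%N T5; have T20 := sqr0 10%N T10.
have T9 : T 9%N = 0 by rewrite (rec8 1%N) T1 T2 T5 !mulr0 !addr0.
have T11 : T 11%N = X ^+ 5 by rewrite (rec8 3%N) T3 T4 T7 !mulr0 !add0r -exprSr.
have T13 : T 13%N = 0 by rewrite (rec8 5%N) T5 T6 T9 !mulr0 !addr0.
have T15 : T 15%N = 0.
  rewrite (rec8 7%N) T7 T8 T11 mulr0 addr0 -exprSr -exprD.
  exact: addrr_pchar2 char2 _.
have T17 : T 17%N = 0 by rewrite (rec8 9%N) T9 T10 T13 !mulr0 !addr0.
have T19 : T 19%N = X ^+ 13 by rewrite (rec8 11%N) T11 T12 T15 !mulr0 !addr0 -exprD.
have T23 : T 23%N = X ^+ 17 by rewrite (rec8 15%N) T15 T16 T19 !mulr0 !add0r -exprD.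
have T29 : T 29%N = X ^+ 11 by rewrite (rec24 5%N) T5 T8 T11 !mulr0 !add0r -exprD.
split; split=> //.
- by rewrite (rec24 11%N) T11 (sqr 7%N) T7 T17 mulr0 addr0 -!exprD.
- by rewrite (rec24 17%N) T17 T20 T23 !mulr0 !add0r -exprD.
- by rewrite (rec24 23%N) T23 (sqr0 13%N T13) T29 mulr0 addr0 -!exprD.
Qed.

(** * Binary digits of even and odd rank *)

Definition bit (k m : nat) : bool := odd (m %/ 2 ^ k).

Lemma bitS k m : bit k.+1 m = bit k m./2.
Proof. by rewrite /bit expnS divnMA divn2. Qed.

Lemma bit_small k m : (m < 2 ^ k)%N -> bit k m = false.
Proof. by move=> mk; rewrite /bit divn_small. Qed.

Lemma bit_addX k m : bit k (m + 2 ^ k) = ~~ bit k m.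
Proof. by rewrite /bit divnDr // divnn expn_gt0 addn1. Qed.

Definition interleave (u : nat * nat) : nat := (g u.1 + 2 * g u.2)%N.

(* wt, the inverse of interleave, maps m to the pair (a, b) for which D^(5 + 6 m) is
   [a,b,G]; the first argument of wt_rec is fuel. *)
Fixpoint wt_rec (k n : nat) : nat * nat :=
  if k is k'.+1 then let u := wt_rec k' n./2 in (odd n + 2 * u.2, u.1)%N else (0, 0)%N.

Definition wt (n : nat) : nat * nat := wt_rec n n.

Lemma wt_recE k n : (n <= k)%N -> wt_rec k n = wt n.
Proof.
rewrite /wt; elim/ltn_ind: n k => -[|n] IH k le_nk.
  by elim: k {le_nk IH} => //= k ->.
by case: k le_nk => // k le_nk /=; rewrite !(IH (uphalf n)) //; lia.
Qed.

Lemma wtE n : wt n = (odd n + 2 * (wt n./2).2, (wt n./2).1)%N.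
Proof. by rewrite -(@wt_recE n.+1 n) //= wt_recE //; lia. Qed.

Lemma wtK n : interleave (wt n) = n.
Proof.
elim/ltn_ind: n => -[|n] // IH; have := IH n.+1./2 ltac:(lia).
rewrite /interleave [wt n.+1]wtE; case: (wt _) => a b /= IHab; rewrite gE.
have -> : ((~~ odd n + 2 * b)./2 = b)%N by lia.
by lia.
Qed.

Lemma interleaveK u : wt (interleave u) = u.
Proof.
case: u => a b; have [n] := ubnP (3 * a + 4 * b); elim: n a b => // n IH a b abn.
have [ab0|ab0] := posnP (a + b).
  by have [-> ->] : a = 0%N /\ b = 0%N by lia.
have IHba := IH b a./2 ltac:(lia); rewrite /interleave /= (gE a) wtE.
have -> : ((4 * g a./2 + odd a + 2 * g b)./2 = interleave (b, a./2))%N.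
  by rewrite /interleave /=; lia.
by rewrite IHba; congr (_, _); rewrite /=; lia.
Qed.

Lemma bit_wt k m : bit k m = bit k./2 (if odd k then (wt m).2 else (wt m).1).
Proof.
elim: k m => [|k IH] m; rewrite [wt m]wtE /=.
  by rewrite /bit !divn1; lia.
rewrite bitS IH uphalf_half; case: (odd k) => //=.
by rewrite add1n bitS; congr (bit _ _); lia.
Qed.

Lemma wt_addX k m : ~~ bit k m -> wt (m + 2 ^ k) = wt m + wt (2 ^ k).
Proof.
elim: k m => [|k IH] m.
  rewrite /bit divn1 => em; rewrite [LHS]wtE [wt m]wtE.
  have -> : ((m + 2 ^ 0)./2 = m./2)%N by rewrite expn0; lia.
  by congr (_, _); rewrite /= ?addr0 //; lia.
rewrite bitS => /IH IHm; rewrite [LHS]wtE [wt m]wtE [wt (2 ^ _)]wtE.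
have -> : ((m + 2 ^ k.+1)./2 = m./2 + 2 ^ k)%N by rewrite expnS; lia.
have -> : ((2 ^ k.+1)./2 = 2 ^ k)%N by rewrite expnS; lia.
by rewrite IHm oddD oddX addbF; congr (_, _); rewrite /=; lia.
Qed.

Lemma wtX k : wt (2 ^ k) = if odd k then (0, 2 ^ k./2)%N else (2 ^ k./2, 0)%N.
Proof.
elim: k => // k IH; rewrite wtE (_ : (2 ^ k.+1)./2 = 2 ^ k)%N; last by rewrite expnS; lia.
rewrite IH oddX /= uphalf_half; case: (odd k) => //=.
by rewrite add1n expnS.
Qed.

Lemma wtX_SS k : wt (2 ^ k.+2) = wt (2 ^ k) + wt (2 ^ k).
Proof. by rewrite !wtX /= negbK expnS; case: (odd k); congr (_, _); rewrite /=; lia. Qed.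

Lemma wtX_ltS k : earlier (wt (2 ^ k)) (wt (2 ^ k.+1)).
Proof.
rewrite !wtX /= uphalf_half /earlier; have := expn_gt0 2 k./2.
by case: (odd k) => /=; rewrite ?add0n ?add1n ?expnS; lia.
Qed.

(* A carry replaces two digits of rank k by one of rank k + 1. *)
Lemma wtXS_lt_double k : earlier (wt (2 ^ k.+1)) (wt (2 ^ k) + wt (2 ^ k)).
Proof.
rewrite !wtX /= uphalf_half /earlier; have := expn_gt0 2 k./2.
by case: (odd k) => /=; rewrite ?add0n ?add1n ?expnS; lia.
Qed.

Lemma wt_addX_carry k m : bit k m -> earlier (wt (m + 2 ^ k)) (wt m + wt (2 ^ k)).
Proof.
elim/ltn_ind: m k => m IH k bm.
have le_m : (2 ^ k <= m)%N by rewrite leqNgt; apply: contraL bm => /bit_small ->.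
have [m0 em] : exists m0, m = (m0 + 2 ^ k)%N by exists (m - 2 ^ k)%N; rewrite subnK.
have bm0 : ~~ bit k m0 by move: bm; rewrite em bit_addX.
rewrite em (wt_addX bm0) -addnA addnn -mul2n -expnS.
have := wtXS_lt_double k; case: (boolP (bit k.+1 m0)) => [/IH|/wt_addX ->].
  have k0 : (0 < 2 ^ k)%N by rewrite expn_gt0.
  by move=> /(_ ltac:(lia)); rewrite /earlier /=; lia.
by rewrite /earlier /=; lia.
Qed.

Lemma wt_addX_le k m : ~~ earlier (wt m + wt (2 ^ k)) (wt (m + 2 ^ k)).
Proof.
case: (boolP (bit k m)) => [/wt_addX_carry|/wt_addX ->]; rewrite /earlier /=; lia.
Qed.

Lemma ltn_g : {homo g : a b / (a < b)%N}.
Proof.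
move=> a b; elim/ltn_ind: b a => b IH a ab; rewrite (gE a) (gE b).
by have [/(IH b./2 ltac:(lia))| |e] := ltngtP a./2 b./2; rewrite ?e; lia.
Qed.

(** * Leading terms *)

Section Span.
Variables (I : Type) (V : nmodType) (e : I -> V).

Definition in_span (P : pred I) (f : V) : Prop :=
  exists2 s : seq I, all P s & f = \sum_(i <- s) e i.

Lemma in_span0 P : in_span P 0.
Proof. by exists [::]; rewrite ?big_nil. Qed.

Lemma in_span_gen (P : pred I) i : P i -> in_span P (e i).
Proof. by move=> Pi; exists [:: i]; rewrite ?big_seq1 //= Pi. Qed.

Lemma in_spanD P f h : in_span P f -> in_span P h -> in_span P (f + h).
Proof.
by move=> [s ps ->] [t pt ->]; exists (s ++ t); rewrite ?all_cat ?ps // big_cat.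
Qed.

Lemma sub_in_span (P Q : pred I) f : subpred P Q -> in_span P f -> in_span Q f.
Proof. by move=> PQ [s ps ->]; exists s => //; apply: sub_all ps. Qed.

End Span.

Definition mon (m : nat) : series 'F_2 := D ^+ (5 + 6 * m).

Lemma monM j m : D ^+ (6 * j) * mon m = mon (m + j).
Proof. by rewrite /mon -exprD; congr (_ ^+ _); lia. Qed.

Lemma in_span_mulX (P Q : pred nat) j f : (forall u, P u -> Q (u + j)%N) ->
  in_span mon P f -> in_span mon Q (D ^+ (6 * j) * f).
Proof.
move=> PQ [s /allP ps ->]; exists [seq (u + j)%N | u <- s].
  by apply/allP => _ /mapP[u /ps pu ->]; apply: PQ.
by rewrite big_map mulr_sumr; apply: eq_bigr => u _; rewrite monM.
Qed.

(* For (a, b) = wt m with a > 0, lead_index m is the index of [a-1,b,G]. *)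
Definition lead_index (m : nat) : nat := interleave ((wt m).1.-1, (wt m).2).

Lemma wt_lead_index m : (0 < (wt m).1)%N -> wt (lead_index m) + (1, 0)%N = wt m.
Proof.
by move=> m0; rewrite interleaveK [RHS]surjective_pairing; congr (_, _); rewrite /=; lia.
Qed.

Lemma lead_indexP m u : wt u + (1, 0)%N = wt m -> lead_index m = u.
Proof.
move=> um; rewrite -[u]wtK /lead_index -um; congr interleave.
by case: (wt u) => a b; congr (_, _); rewrite /=; lia.
Qed.

Lemma lead_index_lt m : (0 < (wt m).1)%N -> (lead_index m < m)%N.
Proof.
move=> m0; rewrite -[X in (_ < X)%N]wtK /interleave /lead_index /=.
by rewrite ltn_add2r ltn_g // prednK.
Qed.

Lemma lead_index_addX k m : (0 < (wt m).1)%N -> ~~ bit k m -> ~~ bit k (lead_index m) ->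
  lead_index (m + 2 ^ k) = (lead_index m + 2 ^ k)%N.
Proof.
move=> m0 bm bl; apply: lead_indexP.
by rewrite !wt_addX // addrAC wt_lead_index.
Qed.

Definition lead (m : nat) : series 'F_2 :=
  if (wt m).1 == 0%N then 0 else mon (lead_index m).

Lemma lead0 m : (wt m).1 = 0%N -> lead m = 0.
Proof. by rewrite /lead => ->. Qed.

Lemma leadE m : (0 < (wt m).1)%N -> lead m = mon (lead_index m).
Proof. by rewrite /lead; case: eqP => // ->. Qed.

(* The leading index has weight exactly wt m - (1, 0), so lower v excludes it
   for v = wt m, whereas lower_eq v does not. *)
Definition lower (v : nat * nat) (u : nat) : bool := earlier (wt u + (1, 0)%N) v.
Definition lower_eq (v : nat * nat) (u : nat) : bool := ~~ earlier v (wt u + (1, 0)%N).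

Definition has_lead (m : nat) : Prop :=
  in_span mon (lower (wt m)) (hecke 7 (mon m) + lead m).

Lemma has_lead_of_eq m f : in_span mon (lower (wt m)) f ->
  hecke 7 (mon m) = lead m + f -> has_lead m.
Proof.
by move=> h e; rewrite /has_lead e addrAC (addrr_pchar2 pchar_series) add0r.
Qed.

Lemma has_lead_lower_eq m : has_lead m -> in_span mon (lower_eq (wt m)) (hecke 7 (mon m)).
Proof.
move=> hm; rewrite -[hecke 7 _](addrK_pchar2 pchar_series (lead m)); apply: in_spanD.
  by apply: sub_in_span hm => u; rewrite /lower /lower_eq /earlier /=; lia.
have [m0|m0] := posnP (wt m).1; first by rewrite lead0 //; apply: in_span0.
rewrite leadE //; apply: in_span_gen; rewrite /lower_eq wt_lead_index // /earlier; lia.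
Qed.

Lemma has_lead_mulX v k m :
  has_lead m -> ~~ earlier v (wt m + wt (2 ^ k)) ->
  in_span mon (lower v) (D ^+ (6 * 2 ^ k) * (hecke 7 (mon m) + lead m)).
Proof.
move=> hm vm; apply: in_span_mulX hm => u.
by have := wt_addX_le k u; move: vm; rewrite /lower /earlier /=; lia.
Qed.

Lemma has_lead_mulX_lt v k m :
  has_lead m -> earlier (wt m + wt (2 ^ k)) v ->
  in_span mon (lower v) (D ^+ (6 * 2 ^ k) * hecke 7 (mon m)).
Proof.
move=> /has_lead_lower_eq hm vm; apply: in_span_mulX hm => u.
by have := wt_addX_le k u; move: vm; rewrite /lower /lower_eq /earlier /=; lia.
Qed.

Lemma hecke7_mon_rec k m :
  hecke 7 (mon (m + 2 ^ k.+3)) = D ^+ (6 * 2 ^ k.+3) * hecke 7 (mon m)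
  + D ^+ (6 * 2 ^ k) * hecke 7 (mon (m + 2 ^ k))
  + D ^+ (6 * 2 ^ k.+1) * hecke 7 (mon (m + 2 ^ k.+1)).
Proof.
have := hecke7_rec24 k.+1 (5 + 6 * m); rewrite /= /mon.
have -> : (24 * 2 ^ k.+1 = 6 * 2 ^ k.+3)%N by rewrite !expnS; lia.
have -> : (3 * 2 ^ k.+1 = 6 * 2 ^ k)%N by rewrite !expnS; lia.
by rewrite !mulnDr !(addnA 5).
Qed.

Lemma wt_lt k m : (m < 2 ^ k)%N ->
  ((wt m).1 < 2 ^ uphalf k)%N /\ ((wt m).2 < 2 ^ k./2)%N.
Proof.
elim: k m => [|k IH] m; first by case: m.
by rewrite expnS wtE => mk; have [] := IH m./2 ltac:(lia); rewrite /= expnS; lia.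
Qed.

Lemma lt_exp2_bit k m : (m < 2 ^ k.+1)%N -> ~~ bit k m -> (m < 2 ^ k)%N.
Proof.
rewrite /bit expnS -ltn_divLR ?expn_gt0 // -[X in _ -> _ -> (_ < X)%N]mul1n.
by rewrite -ltn_divLR ?expn_gt0 //; case: (m %/ _)%N => [|[]].
Qed.

Lemma bit_lead_index k m : (m < 2 ^ k.+2)%N -> (0 < (wt m).1)%N ->
  ~~ bit k m -> ~~ bit k (lead_index m).
Proof.
move=> /wt_lt[/= mk _] m0; rewrite (bit_wt k m) (bit_wt k (lead_index m)) interleaveK /=.
have [//|ek] := boolP (odd k); rewrite uphalf_half (negbTE ek) in mk.
move=> /(lt_exp2_bit mk) mk'; rewrite bit_small //.
exact: leq_ltn_trans (leq_pred _) mk'.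
Qed.

(* Only two terms of hecke7_mon_rec may reach the leading monomial: the first one when
   (wt m).1 > 0, and the third one when (wt m).1 = 0. *)
Section Step.
Variables k m : nat.
Hypotheses (mk : (m < 2 ^ k.+3)%N) (m_lead : has_lead m).
Hypotheses (mk_lead : has_lead (m + 2 ^ k.+1)).

Let v := wt (m + 2 ^ k.+3).

Let vE : v = wt m + wt (2 ^ k.+1) + wt (2 ^ k.+1).
Proof. by rewrite /v wt_addX ?bit_small // wtX_SS addrA. Qed.

Lemma third_term_lower_of_carry : bit k.+1 m ->
  in_span mon (lower v) (D ^+ (6 * 2 ^ k.+1) * hecke 7 (mon (m + 2 ^ k.+1))).
Proof.
move=> bm; apply: has_lead_mulX_lt => //.
by have := wt_addX_carry bm; rewrite vE /earlier /=; lia.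
Qed.

Lemma third_term_mod_lead : ~~ bit k.+1 m ->
  in_span mon (lower v) (D ^+ (6 * 2 ^ k.+1) *
    (hecke 7 (mon (m + 2 ^ k.+1)) + lead (m + 2 ^ k.+1))).
Proof.
move=> bm; apply: has_lead_mulX => //.
by rewrite vE wt_addX // /earlier; lia.
Qed.

Lemma first_term_mod_lead :
  in_span mon (lower v) (D ^+ (6 * 2 ^ k.+3) * (hecke 7 (mon m) + lead m)).
Proof.
apply: has_lead_mulX => //.
by rewrite /v wt_addX ?bit_small // /earlier; lia.
Qed.

Lemma lead_addX_top : (0 < (wt m).1)%N ->
  lead (m + 2 ^ k.+3) = D ^+ (6 * 2 ^ k.+3) * lead m.
Proof.
move=> m0; have lm := ltn_trans (lead_index_lt m0) mk.
have w0 : (0 < (wt (m + 2 ^ k.+3)).1)%N by rewrite wt_addX ?bit_small //= addn_gt0 m0.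
by rewrite !leadE // monM lead_index_addX ?bit_small.
Qed.

Lemma third_term_lower : (0 < (wt m).1)%N ->
  in_span mon (lower v) (D ^+ (6 * 2 ^ k.+1) * hecke 7 (mon (m + 2 ^ k.+1))).
Proof.
move=> m0; have [|bm] := boolP (bit k.+1 m); first exact: third_term_lower_of_carry.
rewrite -[hecke 7 _](addrK_pchar2 pchar_series (lead (m + 2 ^ k.+1))) mulrDr.
apply: in_spanD; first exact: third_term_mod_lead.
have w0 : (0 < (wt (m + 2 ^ k.+1)).1)%N by rewrite wt_addX //= addn_gt0 m0.
have bl := bit_lead_index mk m0 bm.
rewrite leadE // lead_index_addX // monM; apply: in_span_gen.
have := @wt_addX_carry k.+1 (lead_index m + 2 ^ k.+1); rewrite bit_addX => /(_ bl).
by rewrite (wt_addX bl) /lower vE -(wt_lead_index m0) /earlier /=; lia.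
Qed.

Lemma lead_addX_third : (wt m).1 = 0%N -> ~~ bit k.+1 m ->
  lead (m + 2 ^ k.+3) = D ^+ (6 * 2 ^ k.+1) * lead (m + 2 ^ k.+1).
Proof.
move=> m0 bm; have vwt : v = wt (m + 2 ^ k.+1) + wt (2 ^ k.+1) by rewrite vE wt_addX.
have [w0|w0] := posnP (wt (m + 2 ^ k.+1)).1.
  rewrite [in RHS]lead0 // mulr0 lead0 // -/v vE /=.
  by move: w0; rewrite wt_addX //=; lia.
have bl : ~~ bit k.+1 (lead_index (m + 2 ^ k.+1)).
  move: w0; rewrite bit_wt interleaveK wt_addX //= m0 wtX /=.
  case: (odd k) => //= _; rewrite add0r.
  by rewrite bit_small // ltn_predL expn_gt0.
have v0 : (0 < v.1)%N by rewrite vwt /= addn_gt0 w0.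
rewrite !leadE // monM; congr mon; apply: lead_indexP.
by rewrite -/v vwt wt_addX // addrAC wt_lead_index.
Qed.

Lemma third_term_mod_top_lead : (wt m).1 = 0%N ->
  in_span mon (lower v)
    (D ^+ (6 * 2 ^ k.+1) * hecke 7 (mon (m + 2 ^ k.+1)) + lead (m + 2 ^ k.+3)).
Proof.
move=> m0; have [bm|bm] := boolP (bit k.+1 m); last first.
  by rewrite lead_addX_third // -mulrDr; exact: third_term_mod_lead.
rewrite lead0 ?addr0; first exact: third_term_lower_of_carry.
rewrite wt_addX ?bit_small //= m0 wtX /=; move: bm; rewrite bit_wt m0 /=.
by case: (odd k) => //=; rewrite bit_small ?expn_gt0.
Qed.

Lemma second_term_lower : has_lead (m + 2 ^ k) ->
  in_span mon (lower v) (D ^+ (6 * 2 ^ k) * hecke 7 (mon (m + 2 ^ k))).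
Proof.
move=> mk2_lead; apply: has_lead_mulX_lt => //.
by have := wtX_ltS k; have := wt_addX_le k m; rewrite vE /earlier /=; lia.
Qed.

Lemma has_lead_addX_top : has_lead (m + 2 ^ k) -> has_lead (m + 2 ^ k.+3).
Proof.
move=> mk2_lead; have reorder (A B C L : series 'F_2) : A + B + C + L = B + (A + (C + L)).
  by rewrite -!addrA addrCA.
rewrite /has_lead hecke7_mon_rec reorder; apply: in_spanD; first exact: second_term_lower.
have [m0|m0] := posnP (wt m).1.
  apply: in_spanD; last exact: third_term_mod_top_lead.
  by have := first_term_mod_lead; rewrite lead0 // addr0.
rewrite addrCA; apply: in_spanD; first exact: third_term_lower.
by rewrite lead_addX_top // -mulrDr; exact: first_term_mod_lead.
Qed.

End Step.

Lemma has_lead_small m : (m < 8)%N -> has_lead m.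
Proof.
have [[T11 T17 T23] [T29 T35 T41 T47]] := small_values_of_recurrences
  (T := fun n => hecke 7 (D ^+ n)) pchar_series hecke7_sqr hecke7_rec8 (hecke7_rec24 0)
  (hecke7_D_exp2 0) hecke7_D3 hecke7_D5 hecke7_D7.
have exact_lead n : hecke 7 (mon n) = lead n -> has_lead n.
  by move=> e; apply: (@has_lead_of_eq _ 0); [apply: in_span0|rewrite e addr0].
case: m => [|[|[|[|[|[|[|[|//]]]]]]]] _.
- exact: exact_lead 0%N hecke7_D5.
- exact: exact_lead 1%N T11.
- exact: exact_lead 2%N T17.
- exact: exact_lead 3%N T23.
- exact: exact_lead 4%N T29.
- by apply: (@has_lead_of_eq _ (mon 0)); [apply: in_span_gen|exact: T35].
- exact: exact_lead 6%N T41.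
- by apply: (@has_lead_of_eq _ (mon 2)); [apply: in_span_gen|exact: T47].
Qed.

Lemma has_leadT m : has_lead m.
Proof.
elim/ltn_ind: m => m IH; have [|m8] := ltnP m 8; first exact: has_lead_small.
have [k [km mk]] : exists k, (2 ^ k.+3 <= m)%N /\ (m < 2 ^ k.+4)%N.
  have log3 : (3 <= trunc_log 2 m)%N by rewrite trunc_log_max.
  exists (trunc_log 2 m - 3)%N; rewrite -addn3 subnK //.
  by rewrite trunc_logP ?trunc_log_ltn //; lia.
have [m' em] : exists m', m = (m' + 2 ^ k.+3)%N.
  by exists (m - 2 ^ k.+3)%N; rewrite subnK.
have k0 : (0 < 2 ^ k)%N by rewrite expn_gt0.
rewrite em; apply: has_lead_addX_top; try apply: IH.
all: by rewrite em !expnS in mk *; lia.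
Qed.

Lemma monGE a b : monG a b = mon (interleave (a, b)).
Proof. by rewrite /monG /mon /interleave; congr (_ ^+ _); rewrite /=; lia. Qed.

Lemma hecke7_monG a b : exists2 s : seq (nat * nat),
  {in s, forall u, earlier (u + (1, 0)%N) (a, b)} &
  hecke 7 (monG a b) =
    (if a is a'.+1 then monG a' b else 0) + \sum_(u <- s) monG u.1 u.2.
Proof.
have [s /allP lower_s es] := has_leadT (interleave (a, b)); exists (map wt s).
  by move=> _ /mapP[m /lower_s + ->]; rewrite /lower interleaveK.
have -> : hecke 7 (monG a b) = lead (interleave (a, b)) + \sum_(m <- s) mon m.
  by rewrite monGE -es addrCA (addrr_pchar2 pchar_series) addr0.
congr (_ + _).
  case: a {lower_s es} => [|a]; first by rewrite lead0 // interleaveK.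
  by rewrite monGE leadE /lead_index interleaveK.
by rewrite big_map; apply: eq_bigr => m _; rewrite monGE -surjective_pairing wtK.
Qed.

Theorem theorem2p24 (a b : nat) :
  (exists s : seq (nat * nat),
     (forall c d : nat, (c, d) \in s -> (c + d < a + b)%N) /\
     hecke 7 (monG a b) = \sum_(u <- s) monG u.1 u.2) /\
  ((0 < a)%N ->
   exists s : seq (nat * nat),
     (forall c d : nat, (c, d) \in s -> earlier (c, d) ((a - 1)%N, b)) /\
     hecke 7 (monG a b) = monG (a - 1) b + \sum_(u <- s) monG u.1 u.2).
Proof.
have [s sP ->] := hecke7_monG a b; split.
- case: a sP => [|a] sP; [exists s|exists ((a, b) :: s)]; split.
  + by move=> c d /sP; rewrite /earlier /=; lia.
  + by rewrite add0r.
  + by move=> c d; rewrite inE => /predU1P[[-> ->]|/sP]; rewrite /earlier /=; lia.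
  + by rewrite big_cons.
- case: a sP => // a sP _; exists s; rewrite subn1; split=> // c d /sP.
  by rewrite /earlier /=; lia.
Qed.
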